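(* Consider the family of two-sided queueing systems on the bipartite graph $G(N\cup M,E)$ indexed by the scaling parameter $\eta\in\mathbb{N}$. Let $\gamma>0$ be any constant, let $q_{\max}^{\eta}=\gamma\sqrt{\eta}$, and operate the $\eta$-th system under the fluid pricing policy with buffer size $q_{\max}^\eta$, $$\lambda_j(\mathbf q)=\eta\lambda_j^*\,\mathbf 1\{q_j^{(c)}<q_{\max}^\eta\}\ (j\in M),\qquad \mu_i(\mathbf q)=\eta\mu_i^*\,\mathbf 1\{q_i^{(s)}<q_{\max}^\eta\}\ (i\in N),$$ together with max-weight matching. Then the profit loss satisfies $L^\eta=O(\sqrt{\eta})$ as $\eta\to\infty$.
   Context: **Model.** $N$ is a set of $n$ server types, $M$ a set of $m$ customer types, $E\subseteq N\times M$ the set of compatible pairs. The state $\mathbf q=(q^{(c)}_j,j\in M;\ q^{(s)}_i,i\in N)\in\mathbb Z_+^{m+n}$ records the numbers of waiting customers and servers of each type. In state $\mathbf q$, type-$j$ customers arrive at Poisson rate $\lambda_j(\mathbf q)$ and type-$i$ servers at Poisson rate $\mu_i(\mathbf q)$, chosen by the operator (pricing). A matched compatible pair leaves at once. **Curves.** $F_j$ (inverse demand curve) is strictly decreasing, $G_i$ (inverse supply curve) is strictly increasing; both are nonnegative and twice continuously differentiable on the range of feasible rates, $\lambda\mapsto\lambda F_j(\lambda)$ has strictly negative second derivative, $\mu\mapsto\mu G_i(\mu)$ has strictly positive second derivative. Unit waiting costs $s_j^{(c)},s_i^{(s)}>0$ are given. **Fluid problem.** $\gamma^*=\max\sum_j\lambda_jF_j(\lambda_j)-\sum_i\mu_iG_i(\mu_i)$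 over $\boldsymbol\lambda,\boldsymbol\mu,\boldsymbol\chi$ subject to $\lambda_j=\sum_i\chi_{ij}$, $\mu_i=\sum_j\chi_{ij}$, $\chi_{ij}\ge0$ for $(i,j)\in E$ and $\chi_{ij}=0$ for $(i,j)\notin E$. $(\boldsymbol\lambda^*,\boldsymbol\mu^*,\boldsymbol\chi^* )$ denotes an optimal solution; it is assumed that $\boldsymbol\lambda^*,\boldsymbol\mu^*>0$. **Scaling.** The $\eta$-th system has the same graph and waiting costs, with curves $F^\eta_j(\eta\lambda)=F_j(\lambda)$, $G_i^\eta(\eta\mu)=G_i(\mu)$; its fluid optimum is $\eta\gamma^*$. **Profit loss.** With $\mathbb E$ the stationary expectation, $$L^\eta=\eta\gamma^*-\Big(\mathbb E\Big[\sum_j\lambda_j(\mathbf q)F_j^\eta(\lambda_j(\mathbf q))-\sum_i\mu_i(\mathbf q)G_i^\eta(\mu_i(\mathbf q))\Big]-\sum_js_j^{(c)}\mathbb E[q_j^{(c)}]-\sum_is_i^{(s)}\mathbb E[q_i^{(s)}]\Big).$$ **Max-weight matching.** An arriving server of type $i$ is immediately matched with a waiting customer of a type $j$ maximizing $q_j^{(c)}$ over $\{j:(i,j)\in E\}$ if this maximum is positive; symmetrically for an arriving customer. Ties are broken arbitrarily. If all compatible queues are empty, the arrival joins its own queue. *)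

(* Defs.v *)
(* MathComp-Analysis *)
From HB Require Import structures.
From mathcomp Require Import all_boot all_order all_algebra.
From mathcomp Require Import all_classical all_reals all_analysis.

Set Implicit Arguments.
Unset Strict Implicit.
Unset Printing Implicit Defensive.

Import Order.TTheory GRing.Theory Num.Theory.
Import numFieldNormedType.Exports.

Local Open Scope classical_set_scope.
Local Open Scope ring_scope.

(** * Curves on an interval of feasible rates *)

(* [f'] is the derivative of [f] relative to [I] (one-sided at an end point
   belonging to [I]). *)
Definition deriv_on (R : realType) (I : interval R) (f f' : R -> R) : Prop :=
  forall x, x \in I ->
    (f y - f x) / (y - x) @[y --> within ([set` I] `\ x) (nbhs x)] --> f' x.

Definition deriv2_on (R : realType) (I : interval R) (f f'' : R -> R) : Prop :=
  exists2 f' : R -> R, deriv_on I f f' & deriv_on I f' f''.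

Definition C2_on (R : realType) (I : interval R) (f : R -> R) : Prop :=
  exists2 f'' : R -> R, deriv2_on I f f'' & {within [set` I], continuous f''}.

Definition inverse_demand (R : realType) (I : interval R) (f : R -> R) : Prop :=
  [/\ {in I &, forall x y, x < y -> f y < f x},
      {in I, forall x, 0 <= f x},
      C2_on I f &
      exists2 r'' : R -> R, deriv2_on I (fun x => x * f x) r''
                          & {in I, forall x, r'' x < 0}].

Definition inverse_supply (R : realType) (I : interval R) (g : R -> R) : Prop :=
  [/\ {in I &, forall x y, x < y -> g x < g y},
      {in I, forall x, 0 <= g x},
      C2_on I g &
      exists2 c'' : R -> R, deriv2_on I (fun x => x * g x) c''
                          & {in I, forall x, 0 < c'' x}].

(** * Fluid problem *)

Section Fluid.
Variables (R : realType) (N M : finType) (E : {set N * M}).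
Variables (IF : M -> interval R) (IG : N -> interval R).
Variables (F : M -> R -> R) (G : N -> R -> R).

Definition fluid_profit (lam : M -> R) (mu : N -> R) : R :=
  \sum_j lam j * F j (lam j) - \sum_i mu i * G i (mu i).

(* The curves are only meaningful on the ranges [IF j] and [IG i], so the rates
   of a feasible point are taken there. *)
Definition fluid_feasible (lam : M -> R) (mu : N -> R) (chi : N -> M -> R) :=
  [/\ (forall j, lam j = \sum_i chi i j) /\ (forall i, mu i = \sum_j chi i j),
      forall i j, (i, j) \in E -> 0 <= chi i j,
      forall i j, (i, j) \notin E -> chi i j = 0 &
      (forall j, lam j \in IF j) /\ (forall i, mu i \in IG i)].

Definition fluid_optimal (lam : M -> R) (mu : N -> R) (chi : N -> M -> R) :=
  fluid_feasible lam mu chi /\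
  forall lam' mu' chi', fluid_feasible lam' mu' chi' ->
    fluid_profit lam' mu' <= fluid_profit lam mu.

End Fluid.

(** * States of the queueing system *)

(* Customer queue lengths, then server queue lengths; every set of states is
   measurable. *)
Definition state (N M : finType) : Type := ({ffun M -> nat} * {ffun N -> nat})%type.

Section State.
Variables N M : finType.

HB.instance Definition _ := Choice.on (state N M).
HB.instance Definition _ := isPointed.Build (state N M)
  ([ffun=> 0%N], [ffun=> 0%N]).
HB.instance Definition _ := @isMeasurable.Build default_measure_display
  (state N M) discrete_measurable discrete_measurable0
  discrete_measurableC discrete_measurableU.

Definition qc (q : state N M) (j : M) : nat := q.1 j.
Definition qs (q : state N M) (i : N) : nat := q.2 i.

Definition add_customer (q : state N M) (j : M) : state N M :=
  ([ffun k => (qc q k + (k == j))%N], q.2).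
Definition remove_customer (q : state N M) (j : M) : state N M :=
  ([ffun k => (qc q k - (k == j))%N], q.2).
Definition add_server (q : state N M) (i : N) : state N M :=
  (q.1, [ffun k => (qs q k + (k == i))%N]).
Definition remove_server (q : state N M) (i : N) : state N M :=
  (q.1, [ffun k => (qs q k - (k == i))%N]).

Variable E : {set N * M}.

Definition customer_waits (q : state N M) (i : N) : bool :=
  [exists j, ((i, j) \in E) && (0 < qc q j)%N].
Definition server_waits (q : state N M) (j : M) : bool :=
  [exists i, ((i, j) \in E) && (0 < qs q i)%N].

(* Since matched pairs leave at once, no customer and server of compatible types
   wait together. *)
Definition no_waiting_pair : set (state N M) :=
  [set q | forall i j, (i, j) \in E -> qc q j = 0%N \/ qs q i = 0%N].

End State.

(** * Matching policies *)

(* [match_server q i j] is the probability that a type-[i] server arriving in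
   state [q] is matched with a type-[j] customer, and symmetrically for
   [match_customer q j i]; they are only used when a compatible agent waits.
   Probabilities, rather than functions, also cover randomized tie-breaking. *)
Record matching (R : realType) (N M : finType) := Matching {
  match_server : state N M -> N -> M -> R;
  match_customer : state N M -> M -> N -> R
}.

Definition max_weight (R : realType) (N M : finType) (E : {set N * M})
    (w : matching R N M) : Prop :=
  (forall q i, customer_waits E q i ->
    [/\ forall j, 0 <= match_server w q i j,
        \sum_j match_server w q i j = 1 &
        forall j, match_server w q i j != 0 ->
          (i, j) \in E /\ forall k, (i, k) \in E -> (qc q k <= qc q j)%N]) /\
  (forall q j, server_waits E q j ->
    [/\ forall i, 0 <= match_customer w q j i,
        \sum_i match_customer w q j i = 1 &
        forall i, match_customer w q j i != 0 ->
          (i, j) \in E /\ forall k, (k, j) \in E -> (qs q k <= qs q i)%N]).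

(** * The Markov chain and its stationary distributions *)

Section Chain.
Variables (R : realType) (N M : finType) (E : {set N * M}).
Variables (lam : state N M -> M -> R) (mu : state N M -> N -> R).
Variable w : matching R N M.

Definition generator (f : state N M -> R) (q : state N M) : R :=
  \sum_j lam q j *
    (if server_waits E q j
     then \sum_i match_customer w q j i * (f (remove_server q i) - f q)
     else f (add_customer q j) - f q) +
  \sum_i mu q i *
    (if customer_waits E q i
     then \sum_j match_server w q i j * (f (remove_customer q j) - f q)
     else f (add_server q i) - f q).

(* [generator \1_[set r] q] is the (q, r) entry of the rate matrix Q, so the
   second condition is the global balance equation P Q = 0; for bounded rates,
   as under the pricing policy below, it characterizes invariance. *)
Definition stationary (P : probability (state N M) R) : Prop :=
  P (no_waiting_pair E) = 1%E /\
  forall r : state N M, ('E_P[generator \1_[set r]] = 0)%E.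

End Chain.

(** * Pricing, scaling and profit loss *)

Section Profit.
Variables (R : realType) (N M : finType).

Definition fluid_price_customer (eta : nat) (lams : M -> R) (qmax : R)
    (q : state N M) (j : M) : R :=
  if (qc q j)%:R < qmax then eta%:R * lams j else 0.

Definition fluid_price_server (eta : nat) (mus : N -> R) (qmax : R)
    (q : state N M) (i : N) : R :=
  if (qs q i)%:R < qmax then eta%:R * mus i else 0.

(* The curve of the [eta]-th system: [scaled eta f (eta * x) = f x]. *)
Definition scaled (eta : nat) (f : R -> R) (x : R) : R := f (x / eta%:R).

Variables (F : M -> R -> R) (G : N -> R -> R) (sc : M -> R) (ss : N -> R).

(* Extended-real valued, so that an infinite mean queue length is an infinite
   loss.  A rate 0 contributes 0 to the revenue and to the cost, even if 0 is
   not in the domain of the curve. *)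
Definition profit_loss (eta : nat) (gammastar : R)
    (lam : state N M -> M -> R) (mu : state N M -> N -> R)
    (P : probability (state N M) R) : \bar R :=
  ((eta%:R * gammastar)%:E -
   ('E_P[fun q => (\sum_j lam q j * scaled eta (F j) (lam q j) -
                   \sum_i mu q i * scaled eta (G i) (mu q i))%R]
    - \sum_j (sc j)%:E * 'E_P[fun q => ((qc q j)%:R)%R]
    - \sum_i (ss i)%:E * 'E_P[fun q => ((qs q i)%:R)%R]))%E.

End Profit.

(* Main.v *)
(* A queue longer than the buffer is never fed, while max-weight keeps serving
   it, so any stationary law lives on finitely many states and E[A f] = 0 for the
   generator A and every f.  Take f = sum_j qc_j^2 + sum_i qs_i^2.  An arrival of
   type j changes f by 2 (qc_j - max_{i ~ j} qs_i) + 1.  If no rate were switched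
   off, routing along the fluid flow chi would show that the quadratic terms are
   nonpositive in total, as max-weight serves the longest compatible queue; a
   full queue faces only empty ones, so switching its rate off subtracts a
   further 2 qmax times that rate.  Hence
     2 qmax (sum_j lam_j P(j full) + sum_i mu_i P(i full))
       <= sum_j lam_j + sum_i mu_i,
   so the lost revenue is O(eta / qmax) and the waiting cost O(qmax); both are
   O(sqrt eta).
   Existence: a left null vector v of the finite rate matrix gives the invariant
   vector |v|. *)
Require Import Defs.
From HB Require Import structures.
From mathcomp Require Import all_boot all_order all_algebra.
From mathcomp Require Import all_classical all_reals all_analysis.
From mathcomp Require Import ring lra.

Set Implicit Arguments.
Unset Strict Implicit.
Unset Printing Implicit Defensive.

Import Order.TTheory GRing.Theory Num.Theory.
Import numFieldNormedType.Exports.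

Local Open Scope classical_set_scope.
Local Open Scope ring_scope.

(** * Laws on a countable state space: finite supports and mixtures *)

Lemma sum_indic (R : realType) (T : eqType) (s : seq T) (f : T -> R) (r : T) :
  uniq s -> (r \notin s -> f r = 0) ->
  \sum_(q <- s) f q * \1_[set q] r = f r.
Proof.
move=> us f0; have [rs|/[dup] rs /f0 ->] := boolP (r \in s); last first.
  rewrite big_seq big1// => q qs; rewrite indicE memNset ?mulr0//=.
  by move=> rq; rewrite rq qs in rs.
rewrite (bigD1_seq r)//= indicE mem_set// mulr1 big1 ?addr0// => q qr.
by rewrite indicE memNset ?mulr0//= => rq; rewrite rq eqxx in qr.
Qed.

Section FiniteSupport.
Variables (R : realType) (N M : finType).

(** [X] agrees almost everywhere with a finite combination of point indicators, and these are
    integrated one by one. *)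
Lemma expectation_finite_support (P : probability (state N M) R)
    (s : seq (state N M)) (X : state N M -> R) :
  uniq s -> {ae P, forall q, q \notin s -> X q = 0} ->
  'E_P[X]%E = (\sum_(q <- s) fine (P [set q]) * X q)%:E.
Proof.
move=> us X0; rewrite unlock.
have intX r : P.-integrable setT (fun q => (X r)%:E * (\1_[set r] q)%:E)%E.
  by apply: integrableZl => //; exact: integrable_indic.
pose g q := (\sum_(r <- s) (X r)%:E * (\1_[set r] q)%:E)%E.
rewrite (@ae_eq_integral _ _ _ _ _ g) => //.
  rewrite integral_sum// -sumEFin; apply: eq_bigr => r _.
  rewrite integralZl//; last exact: integrable_indic.
  by rewrite integral_indic// setIT EFinM muleC fineK// fin_num_measure.
apply: filterS X0 => q /= Xq _; rewrite /g.
by under eq_bigr do rewrite -EFinM; rewrite sumEFin sum_indic.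
Qed.

(** States are countable: the exceptional set is a union, over the codes given by [pickle], of sets
    that are empty or a single null state. *)
Lemma ae_discrete (P : probability (state N M) R) (A : set (state N M)) :
  (forall q, P [set q] != 0%E -> A q) -> {ae P, forall q, A q}.
Proof.
move=> PA; suff: P.-negligible (~` A) by [].
have -> : ~` A =
  \bigcup_k [set q : state N M | pickle (q : _ * _)%type = k /\ ~ A q].
  by apply/seteqP; split => [q Aq|q [k _ []]]//; exists (pickle (q : _ * _)%type).
apply: negligible_bigcup => k.
have [[q [<- Aq]]|no] := pselect (exists q : state N M, pickle (q : _ * _)%type = k /\ ~ A q).
  exists [set q]; split => //.
    by have [//|/PA] := eqVneq (P [set q]) 0%E.
  by move=> r /= [/(pcan_inj pickleK)].
by apply: (negligibleS _ (negligible_set0 _)) => q /= ?; apply: no; exists q.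
Qed.

Lemma finite_mixture (T : finType) (t0 : T) (x : T -> state N M) (p : T -> R) :
  (forall t, 0 <= p t) -> \sum_t p t = 1 ->
  exists P : probability (state N M) R,
    (forall A, P A = (\sum_t p t * \1_A (x t))%:E) /\
    (forall X, 'E_P[X]%E = (\sum_t p t * X (x t))%:E).
Proof.
move=> p0 p1.
pose m n : {measure set state N M -> \bar R} :=
  mscale (NngNum (p0 (nth t0 (enum T) n))) (dirac (x (nth t0 (enum T) n))).
pose mu : {measure set state N M -> \bar R} := msum m (size (enum T)).
have muE A : mu A = (\sum_t p t * \1_A (x t))%:E.
  by rewrite -big_enum (big_nth t0) big_mkord -sumEFin.
have muT : mu setT = 1%E.
  by rewrite muE -p1; congr EFin; apply: eq_bigr => q _; rewrite indicT mulr1.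
(* The total mass is already 1, so normalizing changes no value and only packages [mu] as a
   probability. *)
have norm1 (nu : {measure set state N M -> \bar R}) (P : probability _ R) A :
    nu setT = 1%E -> mnormalize nu P A = nu A.
  by move=> nuT; rewrite /mnormalize/= nuT onee_eq0/= invr1 mule1.
have [P PE] : exists P : probability (state N M) R,
    forall A, P A = (\sum_t p t * \1_A (x t))%:E.
  by exists (mnormalize mu (dirac point)) => A; rewrite -muE; exact: norm1.
exists P; split=> // X; rewrite (@expectation_finite_support _ (undup (codom x))); last 2 first.
- exact: undup_uniq.
- apply: ae_discrete => q; apply: contra_neqP => /not_implyP[qx _].
  rewrite PE big1// => t _; rewrite indicE memNset ?mulr0//= => xt.
  by move: qx; rewrite mem_undup -xt codom_f.
congr EFin; under eq_bigr => q _ do rewrite PE/= mulr_suml.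
rewrite exchange_big; apply: eq_bigr => t _ /=.
under eq_bigr do rewrite -mulrA [_ * X _]mulrC.
rewrite -mulr_sumr sum_indic ?undup_uniq// => /negP[].
by rewrite mem_undup codom_f.
Qed.

End FiniteSupport.

(** * Invariant laws of finite rate matrices *)

(* [|v|] is invariant as soon as [v] is: it is subinvariant by the triangle
   inequality, and the rows of [Q] sum to zero. *)
Lemma finite_invariant_distribution (R : realFieldType) (T : finType) (t0 : T)
    (Q : T -> T -> R) :
  (forall q r, q != r -> 0 <= Q q r) -> (forall q, \sum_r Q q r = 0) ->
  exists p : T -> R, [/\ forall q, 0 <= p q, \sum_q p q = 1 &
    forall r, \sum_q p q * Q q r = 0].
Proof.
move=> Qge0 Qrow.
have [v [t vt] vQ] : exists2 v : T -> R, exists t, v t != 0 &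
    forall r, \sum_q v q * Q q r = 0.
  pose A := \matrix_(i < #|T|, j < #|T|) Q (enum_val i) (enum_val j).
  have sumE (h : T -> R) : \sum_(k < #|T|) h (enum_val k) = \sum_q h q.
    by rewrite [RHS](reindex (@enum_val T T))//; exact/onW_bij/enum_val_bij.
  have /det0P[v v0 vA] : \det A == 0.
    (* Zero row sums say that the all-ones vector is a right null vector, so the matrix is singular
       and also has a left one. *)
    rewrite -det_tr; apply/det0P; exists (const_mx 1).
      apply/eqP => /matrixP /(_ 0 (enum_rank t0)); rewrite !mxE.
      by move/eqP; rewrite oner_eq0.
    apply/matrixP => i j; rewrite !mxE.
    apply: etrans (Qrow (enum_val j)); rewrite -sumE.
    by apply: eq_bigr => k _; rewrite !mxE mul1r.
  exists (fun q => v 0 (enum_rank q)).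
    have /rV0Pn[i vi] := v0.
    by exists (enum_val i); rewrite enum_valK.
  move=> r; have /matrixP/(_ 0 (enum_rank r)) := vA; rewrite !mxE.
  apply: etrans; rewrite -sumE; apply: eq_bigr => k _.
  by rewrite !mxE enum_valK enum_rankK.
pose g r := \sum_q `|v q| * Q q r.
have g0 r : 0 <= g r.
  have Qrr : Q r r <= 0.
    have := Qrow r; rewrite (bigD1 r)//= => /eqP; rewrite addr_eq0 => /eqP ->.
    by rewrite oppr_le0 sumr_ge0// => q qr; apply: Qge0; rewrite eq_sym.
  have := vQ r; rewrite (bigD1 r)//= => /eqP; rewrite addr_eq0 => /eqP vr.
  rewrite /g (bigD1 r)//= -lerBlDl sub0r -[Q r r]opprK mulrN opprK.
  rewrite -[- Q r r]ger0_norm ?oppr_ge0// -normrM mulrN vr opprK.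
  apply: le_trans (ler_norm_sum _ _ _) _; apply: ler_sum => q qr.
  by rewrite normrM [`|Q q r|]ger0_norm// Qge0.
have gsum : \sum_r g r = 0.
  rewrite exchange_big big1//= => q _.
  by rewrite -mulr_sumr Qrow mulr0.
have gE r : g r = 0.
  by apply: (psumr_eq0P _ gsum).
have S0 : 0 < \sum_q `|v q|.
  rewrite (bigD1 t)//= ltr_pwDl ?normr_gt0// sumr_ge0//.
exists (fun q => `|v q| / \sum_q `|v q|); split.
- by move=> q; rewrite divr_ge0// ltW.
- by rewrite -mulr_suml divff// gt_eqF.
- move=> r; transitivity (g r / \sum_q `|v q|); last by rewrite gE mul0r.
  by rewrite mulr_suml; apply: eq_bigr => q _; rewrite mulrAC.
Qed.

(** Meant for randomized tie-breaking: the weights are the matching probabilities, and only partners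
    of nonzero probability are constrained. *)
Lemma weighted_mean_gt0 (R : realType) (T : finType) (a h : T -> R) (c : R) :
  (forall t, 0 <= a t) -> \sum_t a t = 1 ->
  (forall t, a t != 0 -> c < h t) -> 0 < \sum_t a t * (h t - c).
Proof.
move=> a0 a1 hc.
have t0 t : 0 <= a t * (h t - c).
  have [->|at0] := eqVneq (a t) 0; first by rewrite mul0r.
  by rewrite mulr_ge0// subr_ge0 ltW// hc.
rewrite lt_def sumr_ge0// andbT; apply/eqP => s0.
suff : \sum_t a t = 0 by rewrite a1 => /eqP; rewrite oner_eq0.
rewrite big1// => t _; apply/eqP/negPn/negP => at0.
have /eqP : a t * (h t - c) = 0 by apply: (psumr_eq0P _ s0).
by rewrite mulf_eq0 (negPf at0) subr_eq0 gt_eqF// hc.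
Qed.

Lemma weighted_mean_eq (R : realType) (T : finType) (a h : T -> R) (c : R) :
  \sum_t a t = 1 -> (forall t, a t != 0 -> h t = c) -> \sum_t a t * h t = c.
Proof.
move=> a1 hc; rewrite -[RHS]mul1r -a1 mulr_suml; apply: eq_bigr => t _.
by have [->|/hc ->//] := eqVneq (a t) 0; rewrite !mul0r.
Qed.

(** * Finite boxes of states *)

Section Box.
Variables N M : finType.

(** [state] is not a finite type, so sums over bounded states range over an explicit list. *)
Definition box (L : nat) : seq (state N M) :=
  [seq ([ffun j => val (t.1 j)], [ffun i => val (t.2 i)])
  | t : {ffun M -> 'I_L.+1} * {ffun N -> 'I_L.+1}].

Lemma mem_box L (q : state N M) :
  (q \in box L) = [forall j, qc q j <= L]%N && [forall i, qs q i <= L]%N.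
Proof.
apply/fintype.imageP/andP => [[[f g] _ ->]|[/forallP qcL /forallP qsL]].
  by split; apply/forallP => x; rewrite /qc /qs ffunE -ltnS ltn_ord.
exists ([ffun j => inord (qc q j)], [ffun i => inord (qs q i)]) => //.
rewrite [LHS]surjective_pairing; congr pair; apply/ffunP => x;
  by rewrite !ffunE /= inordK// ltnS.
Qed.

Lemma box_succ L (q : state N M) : q \in box L -> q \in box L.+1.
Proof.
rewrite !mem_box => /andP[/forallP qcL /forallP qsL].
by apply/andP; split; apply/forallP => k; apply: leqW.
Qed.

Lemma box_uniq L : uniq (box L).
Proof.
rewrite map_inj_uniq ?enum_uniq// => -[f g] [f' g'] [/ffunP ff /ffunP gg].
by congr pair; apply/ffunP => x; apply/val_inj; [move: (ff x)|move: (gg x)];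
  rewrite !ffunE.
Qed.

End Box.

(** * Comparison and positivity for the generator, and the balance equations on boxes *)

Section Generator.
Variables (R : realType) (N M : finType) (E : {set N * M}).
Variables (lam : state N M -> M -> R) (mu : state N M -> N -> R).
Variable w : matching R N M.
Local Notation gen := (generator E lam mu w).

(** Transitions that carry a nonzero rate. Claims about the generator then reduce to claims about
    increments along these. *)
Variant jump (q : state N M) : state N M -> Prop :=
| JumpMatchServer j i of lam q j != 0 & server_waits E q j
    & match_customer w q j i != 0 : jump q (remove_server q i)
| JumpAddCustomer j of lam q j != 0 & ~~ server_waits E q j :
    jump q (add_customer q j)
| JumpMatchCustomer i j of mu q i != 0 & customer_waits E q i
    & match_server w q i j != 0 : jump q (remove_customer q j)
| JumpAddServer i of mu q i != 0 & ~~ customer_waits E q i :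
    jump q (add_server q i).

Lemma jump_le (q r : state N M) : jump q r ->
  (forall j, qc q j <= (qc r j).+1)%N /\ (forall i, qs q i <= (qs r i).+1)%N.
Proof.
have lt1 m (b : bool) : (m <= (m - b).+1)%N.
  by rewrite -add1n -leq_subLR leq_sub2l//; case: b.
by case=> *; split => k; rewrite /qc /qs /= ?ffunE ?lt1// ltnW// ltnS leq_addr.
Qed.

Lemma generator_cst (c : R) q : gen (cst c) q = 0.
Proof.
rewrite /generator /= subrr !big1 ?addr0// => k _;
  by case: ifP => _; rewrite ?mulr0// big1 ?mulr0// => l _; rewrite mulr0.
Qed.

Lemma generatorP a (f g : state N M -> R) q :
  gen (fun r => a * f r + g r) q = a * gen f q + gen g q.
Proof.
have lin (x y z t : R) : a * x + y - (a * z + t) = a * (x - z) + (y - t).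
  by rewrite mulrBr opprD addrACA.
rewrite /generator mulrDr addrACA !mulr_sumr -!big_split /=.
congr (_ + _); apply: eq_bigr => k _; rewrite mulrCA -mulrDr; congr (_ * _);
  case: ifP => _; rewrite ?lin// mulr_sumr -big_split/=;
  by apply: eq_bigr => l _; rewrite lin mulrDr mulrCA.
Qed.

Lemma generator_sum (I : Type) (s : seq I) (a : I -> R)
    (f : I -> state N M -> R) q :
  gen (fun r => \sum_(k <- s) a k * f k r) q = \sum_(k <- s) a k * gen (f k) q.
Proof.
elim: s => [|k s IHs].
  rewrite big_nil; apply: etrans (generator_cst 0 q).
  by congr (gen _ q); apply/funext => r; rewrite big_nil.
rewrite big_cons -IHs -generatorP; congr (gen _ q); apply/funext => r.
by rewrite big_cons.
Qed.

Hypothesis lam0 : forall q j, 0 <= lam q j.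
Hypothesis mu0 : forall q i, 0 <= mu q i.
Hypothesis hw : max_weight E w.

(** Terms with a zero rate or a zero matching probability vanish on both sides; every other term is
    a nonnegative weight times an increment along a [jump]. *)
Lemma generator_le (f g : state N M -> R) q :
  (forall r, jump q r -> f r - f q <= g r - g q) -> gen f q <= gen g q.
Proof.
case: hw => ws wc fg; apply: lerD; apply: ler_sum => k _.
  have [->|lk] := eqVneq (lam q k) 0; first by rewrite !mul0r.
  rewrite ler_wpM2l//; case: ifPn => kw; last exact/fg/JumpAddCustomer.
  have [w0 _ _] := wc _ _ kw; apply: ler_sum => l _.
  have [->|wl] := eqVneq (match_customer w q k l) 0; first by rewrite !mul0r.
  by rewrite ler_wpM2l//; apply/fg/(JumpMatchServer lk kw wl).
have [->|mk] := eqVneq (mu q k) 0; first by rewrite !mul0r.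
rewrite ler_wpM2l//; case: ifPn => kw; last exact/fg/JumpAddServer.
have [w0 _ _] := ws _ _ kw; apply: ler_sum => l _.
have [->|wl] := eqVneq (match_server w q k l) 0; first by rewrite !mul0r.
by rewrite ler_wpM2l//; apply/fg/(JumpMatchCustomer mk kw wl).
Qed.

Lemma generator_eq (f g : state N M -> R) q :
  (forall r, jump q r -> f r - f q = g r - g q) -> gen f q = gen g q.
Proof.
by move=> fg; apply/eqP; rewrite eq_le; apply/andP; split;
  apply: generator_le => r /fg ->.
Qed.

(** Kept term by term, so that a single positive term makes the whole generator positive. *)
Lemma jump_terms_ge0 (f : state N M -> R) q :
  (forall r, jump q r -> f q <= f r) ->
  (forall j, 0 <= lam q j *
    (if server_waits E q j
     then \sum_i match_customer w q j i * (f (remove_server q i) - f q)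
     else f (add_customer q j) - f q)) /\
  (forall i, 0 <= mu q i *
    (if customer_waits E q i
     then \sum_j match_server w q i j * (f (remove_customer q j) - f q)
     else f (add_server q i) - f q)).
Proof.
case: hw => ws wc fq; split => k.
  have [->|lk] := eqVneq (lam q k) 0; first by rewrite mul0r.
  rewrite mulr_ge0//; case: ifPn => kw.
    have [w0 _ _] := wc _ _ kw; apply: sumr_ge0 => l _.
    have [->|wl] := eqVneq (match_customer w q k l) 0; first by rewrite mul0r.
    by rewrite mulr_ge0// subr_ge0; apply/fq/(JumpMatchServer lk kw wl).
  by rewrite subr_ge0; exact/fq/JumpAddCustomer.
have [->|mk] := eqVneq (mu q k) 0; first by rewrite mul0r.
rewrite mulr_ge0//; case: ifPn => kw.
  have [w0 _ _] := ws _ _ kw; apply: sumr_ge0 => l _.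
  have [->|wl] := eqVneq (match_server w q k l) 0; first by rewrite mul0r.
  by rewrite mulr_ge0// subr_ge0; apply/fq/(JumpMatchCustomer mk kw wl).
by rewrite subr_ge0; exact/fq/JumpAddServer.
Qed.

Lemma generator_ge0 (f : state N M -> R) q :
  (forall r, jump q r -> f q <= f r) -> 0 <= gen f q.
Proof. by case/jump_terms_ge0 => c0 s0; rewrite addr_ge0// sumr_ge0. Qed.

Lemma generator_gt0_customer (f : state N M -> R) q j :
  (forall r, jump q r -> f q <= f r) -> lam q j != 0 -> server_waits E q j ->
  (forall i, match_customer w q j i != 0 -> f q < f (remove_server q i)) ->
  0 < gen f q.
Proof.
move=> /jump_terms_ge0[c0 s0] lj jw fq.
apply: ltr_pwDl; last exact: sumr_ge0.
rewrite (bigD1 j)//= jw; apply: ltr_pwDl; last exact: sumr_ge0.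
have [w0 w1 _] := hw.2 _ _ jw.
by rewrite mulr_gt0 ?lt_def ?lj//= -lt_def; apply: weighted_mean_gt0.
Qed.

Lemma generator_gt0_server (f : state N M -> R) q i :
  (forall r, jump q r -> f q <= f r) -> mu q i != 0 -> customer_waits E q i ->
  (forall j, match_server w q i j != 0 -> f q < f (remove_customer q j)) ->
  0 < gen f q.
Proof.
move=> /jump_terms_ge0[c0 s0] mi iw fq.
apply: ltr_wpDl; first exact: sumr_ge0.
rewrite (bigD1 i)//= iw; apply: ltr_pwDl; last exact: sumr_ge0.
have [w0 w1 _] := hw.1 _ _ iw.
by rewrite mulr_gt0 ?lt_def ?mi//= -lt_def; apply: weighted_mean_gt0.
Qed.

(** A jump shortens each queue by at most one, so from outside the larger box it cannot enter the
    smaller one. *)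
Lemma generator_box L (f : state N M -> R) q :
  (forall r, r \notin box N M L -> f r = 0) ->
  q \notin box N M L.+1 -> gen f q = 0.
Proof.
move=> f0 qL; rewrite -(generator_cst 0 q); apply: generator_eq => r qr.
have /jump_le[qcr qsr] := qr.
have rL : r \notin box N M L.
  apply: contra qL; rewrite !mem_box => /andP[/forallP rc /forallP rs].
  by apply/andP; split; apply/forallP => k;
    [rewrite (leq_trans (qcr k))// ltnS|rewrite (leq_trans (qsr k))// ltnS].
by rewrite (f0 r)// (f0 q)//; apply: contra qL; exact: box_succ.
Qed.

(** Global balance is stated for point indicators; a function supported in a box is a finite
    combination of them. The sum needs one more layer because [gen f] can be nonzero one jump
    outside the support of [f]. *)
Lemma stationary_sum (P : probability (state N M) R) L (f : state N M -> R) :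
  stationary E lam mu w P -> (forall q, q \notin box N M L -> f q = 0) ->
  \sum_(q <- box N M L.+1) fine (P [set q]) * gen f q = 0.
Proof.
case=> _ bal f0.
have genf q : gen f q = \sum_(r <- box N M L) f r * gen \1_[set r] q.
  by rewrite -generator_sum; congr (gen _ q); apply/funext => r;
    rewrite sum_indic ?box_uniq//; apply: f0.
under eq_bigr do rewrite genf mulr_sumr.
rewrite exchange_big /= big_seq big1// => r rL.
under eq_bigr do rewrite mulrCA.
rewrite -mulr_sumr; apply/eqP; rewrite mulf_eq0; apply/orP; right; apply/eqP.
apply: EFin_inj; apply: etrans (bal r); apply/esym.
apply: expectation_finite_support; first exact: box_uniq.
apply: aeW => q; apply: generator_box => q' q'L.
by rewrite indicE memNset//= => qr; rewrite qr rL in q'L.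
Qed.

End Generator.

(** * Total queue length above a level *)

Section Excess.
Variables (N M : finType) (K : nat).

(** Its sublevel sets lie in boxes, and under the policy it never increases; this is what confines
    stationary laws to [box N M K]. *)
Definition excess (q : state N M) : nat :=
  (\sum_j (qc q j - K) + \sum_i (qs q i - K))%N.

Lemma excess_box n (q : state N M) : (excess q <= n)%N -> q \in box N M (K + n).
Proof.
move=> qn; rewrite mem_box; apply/andP; split; apply/forallP => k;
  rewrite -leq_subLR (leq_trans _ qn)// /excess (bigD1 k)//=.
  by rewrite -addnA leq_addr.
by rewrite addnCA leq_addr.
Qed.

Lemma excess0 (q : state N M) : (excess q == 0%N) = (q \in box N M K).
Proof.
rewrite mem_box /excess addn_eq0 !sum_nat_eq0.
by congr andb; apply: eq_forallb => k; rewrite subn_eq0.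
Qed.

Lemma excess_remove_customer (q : state N M) j :
  (K < qc q j)%N -> (excess (remove_customer q j) < excess q)%N.
Proof.
move=> Kq; rewrite /excess ltn_add2r (bigD1 j)//= [ltnRHS](bigD1 j)//=.
rewrite /qc ffunE eqxx -addSn leq_add//.
  by rewrite subnAC subn1 prednK// subn_gt0.
by apply: leq_sum => k _; rewrite ffunE leq_sub2r// leq_subr.
Qed.

Lemma excess_remove_server (q : state N M) i :
  (K < qs q i)%N -> (excess (remove_server q i) < excess q)%N.
Proof.
move=> Kq; rewrite /excess ltn_add2l (bigD1 i)//= [ltnRHS](bigD1 i)//=.
rewrite /qs ffunE eqxx -addSn leq_add//.
  by rewrite subnAC subn1 prednK// subn_gt0.
by apply: leq_sum => k _; rewrite ffunE leq_sub2r// leq_subr.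
Qed.

End Excess.

(** * Increments of a sum of squares *)

Section SumOfSquares.
Variables (R : realType) (T : finType).

Definition sumsq (v : T -> nat) : R := \sum_t (v t)%:R ^+ 2.

Lemma sumsq_add v t :
  sumsq [ffun k => (v k + (k == t))%N] - sumsq v = 2 * (v t)%:R + 1.
Proof.
rewrite /sumsq (bigD1 t)//= [X in _ - X](bigD1 t)//= ffunE eqxx natrD.
rewrite (eq_bigr (fun k => (v k)%:R ^+ 2)); first by rewrite /=; ring.
by move=> k /negPf kt; rewrite ffunE kt addn0.
Qed.

Lemma sumsq_remove v t : (0 < v t)%N ->
  sumsq [ffun k => (v k - (k == t))%N] - sumsq v = - (2 * (v t)%:R) + 1.
Proof.
move=> v0; rewrite /sumsq (bigD1 t)//= [X in _ - X](bigD1 t)//= ffunE eqxx natrB//.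
rewrite (eq_bigr (fun k => (v k)%:R ^+ 2)); first by rewrite /=; ring.
by move=> k /negPf kt; rewrite ffunE kt subn0.
Qed.

End SumOfSquares.

(** * The chain under fluid pricing and max-weight matching *)

Section FluidPolicy.
Variables (R : realType) (N M : finType) (E : {set N * M}).
Variables (lams : M -> R) (mus : N -> R) (chis : N -> M -> R).
Variables (eta : nat) (qmax : R) (K : nat) (w : matching R N M).
Hypothesis lams_gt0 : forall j, 0 < lams j.
Hypothesis mus_gt0 : forall i, 0 < mus i.
Hypothesis lamsE : forall j, lams j = \sum_i chis i j.
Hypothesis musE : forall i, mus i = \sum_j chis i j.
Hypothesis chis_ge0 : forall i j, (i, j) \in E -> 0 <= chis i j.
Hypothesis chis_eq0 : forall i j, (i, j) \notin E -> chis i j = 0.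
Hypothesis eta_gt0 : (0 < eta)%N.
Hypothesis qmax_gt0 : 0 < qmax.
Hypothesis qmaxK : forall n, n%:R < qmax -> (n < K)%N.
Hypothesis hw : max_weight E w.

Let lam := fluid_price_customer (N := N) eta lams qmax.
Let mu := fluid_price_server (M := M) eta mus qmax.
Local Notation gen := (generator E lam mu w).
Local Notation jump := (jump E lam mu w).

Let etaR_gt0 : 0 < eta%:R :> R. Proof. by rewrite ltr0n. Qed.

Let lam_ge0 q j : 0 <= lam q j.
Proof.
by rewrite /lam /fluid_price_customer; case: ifP => // _; rewrite mulr_ge0// ltW.
Qed.

Let mu_ge0 q i : 0 <= mu q i.
Proof.
by rewrite /mu /fluid_price_server; case: ifP => // _; rewrite mulr_ge0// ltW.
Qed.

Lemma lam_neq0 q j : (lam q j != 0) = ((qc q j)%:R < qmax).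
Proof.
by rewrite /lam /fluid_price_customer; case: ifP; rewrite ?eqxx// mulf_neq0// gt_eqF.
Qed.

Lemma mu_neq0 q i : (mu q i != 0) = ((qs q i)%:R < qmax).
Proof.
by rewrite /mu /fluid_price_server; case: ifP; rewrite ?eqxx// mulf_neq0// gt_eqF.
Qed.

(** A positive fluid rate has to be carried by some edge, since [chis] vanishes off [E]. *)
Lemma customer_neighbor j : exists i, (i, j) \in E.
Proof.
apply/existsP; rewrite -[X in is_true X]negbK negb_exists; apply/negP => /forallP nE.
by have := lams_gt0 j; rewrite lamsE big1 ?ltxx// => i _; rewrite chis_eq0.
Qed.

Lemma server_neighbor i : exists j, (i, j) \in E.
Proof.
apply/existsP; rewrite -[X in is_true X]negbK negb_exists; apply/negP => /forallP nE.
by have := mus_gt0 i; rewrite musE big1 ?ltxx// => j _; rewrite chis_eq0.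
Qed.

(** Only a queue below [qmax], hence shorter than [K], is fed. It has length at most [K] after the
    arrival, so its truncated excess is still 0. *)
Lemma excess_jump q r : jump q r -> (excess K r <= excess K q)%N.
Proof.
have rm m (b : bool) : (m - b - K <= m - K)%N by rewrite leq_sub2r// leq_subr.
case=> [j i _ _ _|j + _|i j _ _ _|i + _].
- by rewrite leq_add2l; apply: leq_sum => k _; rewrite /qs ffunE rm.
- rewrite lam_neq0 => /qmaxK qK; rewrite leq_add2r; apply: leq_sum => k _.
  rewrite /qc ffunE; case: eqVneq => [->|_]; rewrite ?addn0// addn1.
  by rewrite (_ : (_ - K = 0)%N)//; apply/eqP; rewrite subn_eq0.
- by rewrite leq_add2r; apply: leq_sum => k _; rewrite /qc ffunE rm.
- rewrite mu_neq0 => /qmaxK qK; rewrite leq_add2l; apply: leq_sum => k _.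
  rewrite /qs ffunE; case: eqVneq => [->|_]; rewrite ?addn0// addn1.
  by rewrite (_ : (_ - K = 0)%N)//; apply/eqP; rewrite subn_eq0.
Qed.

(** Departures only shorten queues, and an arrival joins its own queue only when no compatible agent
    waits. *)
Lemma no_waiting_pair_jump q r :
  no_waiting_pair E q -> jump q r -> no_waiting_pair E r.
Proof.
move=> nwp; case=> [j i _ _ _|j _ jw|i j _ _ _|i _ iw] i' j' ij';
  have := nwp _ _ ij'; rewrite /qc /qs /= ?ffunE /qc /qs.
- by case=> ->; [left|right].
- move=> h; have [jj'|jj'] := eqVneq j' j; last by rewrite addn0.
  right; apply/eqP; rewrite -leqn0 leqNgt; apply: contra jw => qi.
  by apply/existsP; exists i'; rewrite -jj' ij'.
- by case=> ->; [left|right].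
- move=> h; have [ii'|ii'] := eqVneq i' i; last by rewrite addn0.
  left; apply/eqP; rewrite -leqn0 leqNgt; apply: contra iw => qj.
  by apply/existsP; exists j'; rewrite -ii' ij'.
Qed.

(* A queue longer than [K] is not fed, and a compatible type, which cannot be
   waiting, is matched by max-weight with a queue that is at least as long. *)
Lemma generator_excess_gt0 n q : no_waiting_pair E q -> excess K q = n.+1 ->
  0 < gen (fun r => (excess K r <= n)%N%:R) q.
Proof.
move=> nwp qn.
have le_jump r : jump q r ->
    (excess K q <= n)%N%:R <= (excess K r <= n)%N%:R :> R.
  move=> /excess_jump; rewrite qn ltnn; by case: (excess K r <= n)%N.
have lt_excess r : (excess K r < excess K q)%N ->
    (excess K q <= n)%N%:R < (excess K r <= n)%N%:R :> R.
  by rewrite qn ltnS ltnn => ->.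
have : (0 < excess K q)%N by rewrite qn.
rewrite /excess addn_gt0 !lt0n !sum_nat_eq0 !negb_forall.
case/orP => /existsP[k]; rewrite implyTb -lt0n subn_gt0 => Kq.
  have [i ik] := customer_neighbor k.
  have iw : customer_waits E q i.
    by apply/existsP; exists k; rewrite ik (leq_ltn_trans _ Kq).
  apply: (generator_gt0_server lam_ge0 mu_ge0 hw le_jump _ iw).
    (* Queue [i] faces the nonempty queue [k], so it is empty; being below [qmax], its rate is
       switched on. *)
    have [k0|i0] := nwp _ _ ik; first by rewrite k0 in Kq.
    by rewrite mu_neq0 i0.
  move=> j wj; apply/lt_excess/excess_remove_customer.
  have [_ _ /(_ _ wj)[_ h]] := hw.1 _ _ iw.
  exact: leq_trans Kq (h _ ik).
have [j kj] := server_neighbor k.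
have jw : server_waits E q j.
  by apply/existsP; exists k; rewrite kj (leq_ltn_trans _ Kq).
apply: (generator_gt0_customer lam_ge0 mu_ge0 hw le_jump _ jw).
  have [j0|k0] := nwp _ _ kj; last by rewrite k0 in Kq.
  by rewrite lam_neq0 j0.
move=> i wi; apply/lt_excess/excess_remove_server.
have [_ _ /(_ _ wi)[_ h]] := hw.2 _ _ jw.
exact: leq_trans Kq (h _ kj).
Qed.

(** * Quadratic Lyapunov drift *)

Definition facing_servers (q : state N M) (j : M) : nat :=
  \max_(i | (i, j) \in E) qs q i.
Definition facing_customers (q : state N M) (i : N) : nat :=
  \max_(j | (i, j) \in E) qc q j.

Definition lyapunov (q : state N M) : R := sumsq R (qc q) + sumsq R (qs q).

(* Only full queues have a zero rate, and they face empty queues. *)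
Lemma rate_drift_le (a x y : R) : 0 <= a -> (qmax <= x -> y = 0) ->
  (if x < qmax then a else 0) * (2 * (x - y) + 1) <=
  a * (2 * (x - y) + 1) - 2 * a * qmax * (qmax <= x)%R%:R.
Proof.
move=> a0 xy; case: ltP => [_|qx]; first by rewrite mulr0 subr0.
rewrite (xy qx) mul0r subr0 mulr1; nra.
Qed.

Lemma facing_servers_server_waits q j :
  server_waits E q j -> (0 < facing_servers q j)%N /\
  forall i, match_customer w q j i != 0 -> qs q i = facing_servers q j.
Proof.
move=> jw; have /existsP[i /andP[ij qi]] := jw.
split; first by apply: leq_trans qi _; exact: leq_bigmax_cond.
move=> l wl; have [_ _ /(_ _ wl)[lj h]] := hw.2 _ _ jw.
by apply/eqP; rewrite eqn_leq leq_bigmax_cond//=; apply/bigmax_leqP.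
Qed.

Lemma facing_customers_customer_waits q i :
  customer_waits E q i -> (0 < facing_customers q i)%N /\
  forall j, match_server w q i j != 0 -> qc q j = facing_customers q i.
Proof.
move=> iw; have /existsP[j /andP[ij qj]] := iw.
split; first by apply: leq_trans qj _; exact: (leq_bigmax_cond (F := qc q)).
move=> l wl; have [_ _ /(_ _ wl)[il h]] := hw.1 _ _ iw.
apply/eqP; rewrite eqn_leq (leq_bigmax_cond (F := qc q))//=.
exact/bigmax_leqP.
Qed.

(** One formula covers both outcomes of an arrival. If it is matched, its own queue is empty and a
    longest facing queue loses one; otherwise every facing queue is empty, the maximum is 0, and its
    own queue gains one. *)
Lemma generator_lyapunov q : no_waiting_pair E q ->
  gen lyapunov q =
  \sum_j lam q j * (2 * ((qc q j)%:R - (facing_servers q j)%:R) + 1) +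
  \sum_i mu q i * (2 * ((qs q i)%:R - (facing_customers q i)%:R) + 1).
Proof.
move=> nwp; rewrite /generator; congr (_ + _); apply: eq_bigr => k _;
  congr (_ * _); case: ifPn => kw.
- have [f0 fE] := facing_servers_server_waits kw.
  have /existsP[i /andP[ik qi]] := kw.
  have [k0|i0] := nwp _ _ ik; last by rewrite i0 in qi.
  rewrite k0 sub0r mulrN; have [_ w1 _] := hw.2 _ _ kw.
  apply: weighted_mean_eq w1 _ => l wl; rewrite /lyapunov opprD addrACA subrr add0r.
  by rewrite -(fE l wl) sumsq_remove// (fE l wl).
- have -> : facing_servers q k = 0%N.
    apply/eqP; rewrite -leqn0; apply/bigmax_leqP => i ik.
    by rewrite leqNgt; apply: contra kw => qi; apply/existsP; exists i; rewrite ik.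
  by rewrite subr0 /lyapunov opprD addrACA subrr addr0 sumsq_add.
- have [f0 fE] := facing_customers_customer_waits kw.
  have /existsP[j /andP[kj qj]] := kw.
  have [j0|k0] := nwp _ _ kj; first by rewrite j0 in qj.
  rewrite k0 sub0r mulrN; have [_ w1 _] := hw.1 _ _ kw.
  apply: weighted_mean_eq w1 _ => l wl; rewrite /lyapunov opprD addrACA subrr addr0.
  by rewrite -(fE l wl) sumsq_remove// (fE l wl).
- have -> : facing_customers q k = 0%N.
    apply/eqP; rewrite -leqn0; apply/bigmax_leqP => j kj.
    by rewrite leqNgt; apply: contra kw => qj; apply/existsP; exists j; rewrite kj.
  by rewrite subr0 /lyapunov opprD addrACA subrr add0r sumsq_add.
Qed.

(* The flow [chis] routes every type to compatible types, whose longest queue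
   is what max-weight serves. *)
Lemma flow_le0 q :
  \sum_j lams j * ((qc q j)%:R - (facing_servers q j)%:R) +
  \sum_i mus i * ((qs q i)%:R - (facing_customers q i)%:R) <= 0.
Proof.
have chiM i j (x y : nat) : ((i, j) \in E -> x <= y)%N ->
    chis i j * x%:R <= chis i j * y%:R.
  have [ij /(_ isT) xy|/chis_eq0 -> _] := boolP ((i, j) \in E).
    by rewrite ler_wpM2l ?chis_ge0// ler_nat.
  by rewrite !mul0r.
have cs : \sum_j lams j * (qc q j)%:R <= \sum_i mus i * (facing_customers q i)%:R.
  under eq_bigr do rewrite lamsE mulr_suml.
  under [leRHS]eq_bigr do rewrite musE mulr_suml.
  rewrite exchange_big; apply: ler_sum => i _; apply: ler_sum => j _.
  by apply: chiM => ij; exact: (leq_bigmax_cond (F := qc q)).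
have sc : \sum_i mus i * (qs q i)%:R <= \sum_j lams j * (facing_servers q j)%:R.
  under eq_bigr do rewrite musE mulr_suml.
  under [leRHS]eq_bigr do rewrite lamsE mulr_suml.
  rewrite exchange_big; apply: ler_sum => j _; apply: ler_sum => i _.
  by apply: chiM => ij; exact: leq_bigmax_cond.
under eq_bigr do rewrite mulrBr.
under [X in _ + X]eq_bigr do rewrite mulrBr.
rewrite !sumrB; lra.
Qed.

Let Lambda := \sum_j lams j + \sum_i mus i.

(** Sums [rate_drift_le] over all types; the terms linear in the queue lengths add up to twice the
    quantity in [flow_le0] and are dropped. *)
Lemma generator_lyapunov_le q : no_waiting_pair E q ->
  gen lyapunov q <= eta%:R * (Lambda - 2 * qmax *
    (\sum_j lams j * (qmax <= (qc q j)%:R)%R%:R +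
     \sum_i mus i * (qmax <= (qs q i)%:R)%R%:R)).
Proof.
move=> nwp; rewrite generator_lyapunov//.
(* As [qmax] is positive, a full queue is nonempty, so all compatible queues are empty, as
   [rate_drift_le] requires. *)
have full_gt0 (x : nat) : qmax <= x%:R -> (0 < x)%N.
  by move=> /(lt_le_trans qmax_gt0); rewrite ltr0n.
have cle : \sum_j lam q j * (2 * ((qc q j)%:R - (facing_servers q j)%:R) + 1) <=
    \sum_j (eta%:R * (2 * (lams j * ((qc q j)%:R - (facing_servers q j)%:R)) +
      (lams j - 2 * qmax * (lams j * (qmax <= (qc q j)%:R)%R%:R)))).
  apply: ler_sum => j _; apply: le_trans (rate_drift_le _ _) _.
  - by rewrite mulr_ge0// ltW.
  - move=> /full_gt0 qj; rewrite (_ : facing_servers q j = 0%N)//.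
    apply/eqP; rewrite -leqn0; apply/bigmax_leqP => i ij.
    by have [j0|->//] := nwp _ _ ij; rewrite j0 in qj.
  - by rewrite le_eqVlt; apply/orP; left; apply/eqP; ring.
have sle : \sum_i mu q i * (2 * ((qs q i)%:R - (facing_customers q i)%:R) + 1) <=
    \sum_i (eta%:R * (2 * (mus i * ((qs q i)%:R - (facing_customers q i)%:R)) +
      (mus i - 2 * qmax * (mus i * (qmax <= (qs q i)%:R)%R%:R)))).
  apply: ler_sum => i _; apply: le_trans (rate_drift_le _ _) _.
  - by rewrite mulr_ge0// ltW.
  - move=> /full_gt0 qi; rewrite (_ : facing_customers q i = 0%N)//.
    apply/eqP; rewrite -leqn0; apply/bigmax_leqP => j ij.
    by have [->//|i0] := nwp _ _ ij; rewrite i0 in qi.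
  - by rewrite le_eqVlt; apply/orP; left; apply/eqP; ring.
apply: le_trans (lerD cle sle) _.
rewrite -!mulr_sumr -mulrDr (ler_wpM2l (ltW etaR_gt0))// !big_split/= -!mulr_sumr !sumrN.
rewrite -!mulr_sumr; have := flow_le0 q; rewrite /Lambda; lra.
Qed.

(** * Support and moments of a stationary law *)

Section Stationary.
Variable P : probability (state N M) R.
Hypothesis statP : stationary E lam mu w P.

Let p q := fine (P [set q]).
(** The law lives on [box N M K]; the extra layer is the one in [stationary_sum]. *)
Local Notation "\mean_ q f" := (\sum_(q <- box N M K.+1) p q * f)
  (at level 41, q name, right associativity).

Let p_ge0 q : 0 <= p q. Proof. exact/fine_ge0. Qed.

(** Suppose [q] has mass and excess [n.+1]. The indicator of excess at most [n] has finite support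
    and never decreases along jumps, so its generator is nonnegative everywhere and positive at [q].
    Its stationary mean would then be positive, against [stationary_sum]. *)
Lemma stationary_support q :
  P [set q] != 0%E -> q \in box N M K /\ no_waiting_pair E q.
Proof.
move=> Pq.
have nwp : no_waiting_pair E q.
  apply: contrapT => qE; move/eqP: Pq; apply.
  have nP : P (~` no_waiting_pair E) = 0%E.
    by rewrite probability_setC// statP.1 subee.
  by apply: subset_measure0 nP => // _ ->.
split=> //; rewrite -excess0; case qn : (excess K q) => [//|n].
have p_gt0 : 0 < p q by rewrite fine_gt0// lt0e Pq measure_ge0/= ltey_eq fin_num_measure.
pose f (r : state N M) : R := (excess K r <= n)%N%:R.
have f0 r : r \notin box N M (K + n) -> f r = 0.
  by rewrite /f; case: leqP => // /excess_box ->.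
have gf r : 0 <= gen f r.
  apply: (generator_ge0 lam_ge0 mu_ge0 hw) => r' /excess_jump rr'.
  by rewrite ler_nat; case: (leqP (excess K r) n) => // /(leq_trans rr') ->.
have := stationary_sum lam_ge0 mu_ge0 hw statP f0.
rewrite (bigD1_seq q) ?box_uniq//=; last first.
  (* With excess [n.+1], the state [q] lies in the outer layer of the summation range. *)
  by rewrite -addnS; apply: excess_box; rewrite qn.
move/eqP; rewrite gt_eqF//; apply: ltr_pwDl.
  by rewrite mulr_gt0//; apply: generator_excess_gt0 nwp qn.
by apply: sumr_ge0 => r _; apply: mulr_ge0; [exact: p_ge0|exact: gf].
Qed.

Lemma stationary_expectation (X : state N M -> R) :
  'E_P[X]%E = (\mean_q X q)%:E.
Proof.
apply: expectation_finite_support; first exact: box_uniq.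
apply: ae_discrete => q /stationary_support[qK _] /negP[].
exact: box_succ.
Qed.

Lemma mean1 : \mean_q 1 = 1.
Proof.
by apply: EFin_inj; rewrite -(stationary_expectation (cst 1)) expectation_cst.
Qed.

Lemma mean_le (f g : state N M -> R) :
  (forall q, q \in box N M K -> no_waiting_pair E q -> f q <= g q) ->
  \mean_q f q <= \mean_q g q.
Proof.
move=> fg; apply: ler_sum => q _; have [p0|pq] := eqVneq (p q) 0.
  by rewrite p0 !mul0r.
have Pq : P [set q] != 0%E by apply: contra_neq pq; rewrite /p => ->.
by have [qK nwp] := stationary_support Pq; rewrite ler_wpM2l// fg.
Qed.

(** Cutting [f] off outside the box makes [stationary_sum] applicable. Inside the box the generator
    does not see the cut, because jumps cannot raise an excess of 0. *)
Lemma mean_generator (f : state N M -> R) : \mean_q gen f q = 0.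
Proof.
pose g q := if q \in box N M K then f q else 0.
have g0 q : q \notin box N M K -> g q = 0 by rewrite /g => /negPf ->.
rewrite -[RHS](stationary_sum lam_ge0 mu_ge0 hw statP g0).
have fg q : q \in box N M K -> gen f q = gen g q.
  move=> qK; apply: (generator_eq lam_ge0 mu_ge0 hw) => r /excess_jump rq.
  by rewrite /g qK -excess0 -leqn0 (leq_trans rq)// leqn0 excess0.
by apply/eqP; rewrite eq_le; apply/andP; split; apply: mean_le => q /fg ->.
Qed.

Lemma mean_sub (f g : state N M -> R) :
  \mean_q (f q - g q) = \mean_q f q - \mean_q g q.
Proof. by rewrite -sumrB; apply: eq_bigr => q _; rewrite mulrBr. Qed.

Lemma mean_lin (I : finType) (a : I -> R) (f : I -> state N M -> R) :
  \mean_q (\sum_k a k * f k q) = \sum_k a k * \mean_q f k q.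
Proof.
under eq_bigr do rewrite mulr_sumr.
rewrite exchange_big; apply: eq_bigr => k _; rewrite mulr_sumr.
by apply: eq_bigr => q _; rewrite mulrCA.
Qed.

Let fullc j := \mean_q (qmax <= (qc q j)%:R)%R%:R.
Let fulls i := \mean_q (qmax <= (qs q i)%:R)%R%:R.

(** The drift of [lyapunov] has stationary mean zero, so the mean of its upper bound is
    nonnegative. *)
Lemma full_probability_le :
  2 * qmax * (\sum_j lams j * fullc j + \sum_i mus i * fulls i) <= Lambda.
Proof.
rewrite -subr_ge0 -(pmulr_rge0 _ etaR_gt0).
apply: (@le_trans _ _ (\mean_q gen lyapunov q)); first by rewrite mean_generator.
apply: le_trans (mean_le (fun q _ => @generator_lyapunov_le q)) _.
rewrite le_eqVlt; apply/orP; left; apply/eqP.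
rewrite -!mean_lin -[Lambda in RHS]mulr1 -mean1 !mulr_sumr -big_split/= mulr_sumr.
by rewrite -sumrB mulr_sumr; apply: eq_bigr => q _; ring.
Qed.

(** * Profit loss in terms of full-buffer probabilities and mean queues *)

Section ProfitLoss.
Variables (F : M -> R -> R) (G : N -> R -> R) (sc : M -> R) (ss : N -> R).
Hypothesis sc_gt0 : forall j, 0 < sc j.
Hypothesis ss_gt0 : forall i, 0 < ss i.

(** A rate is either off or [eta] times the fluid rate, where the scaled curve takes its fluid
    value. Each type thus earns its fluid revenue or cost except when its buffer is full, and [eta]
    times the fluid optimum cancels. *)
Lemma profit_lossE :
  profit_loss F G sc ss eta (fluid_profit F G lams mus) lam mu P =
  (eta%:R * (\sum_j F j (lams j) * (lams j * fullc j) -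
             \sum_i G i (mus i) * (mus i * fulls i)) +
   \sum_j sc j * (\mean_q (qc q j)%:R) + \sum_i ss i * (\mean_q (qs q i)%:R))%:E.
Proof.
rewrite /profit_loss stationary_expectation.
have queueE (I : finType) (s : I -> R) (x : I -> state N M -> R) :
    (\sum_k (s k)%:E * 'E_P[x k])%E = (\sum_k s k * \mean_q x k q)%:E.
  by rewrite -sumEFin; apply: eq_bigr => k _; rewrite stationary_expectation EFinM.
rewrite !queueE -!EFinB; congr EFin.
have revenueE (I : finType) (a : I -> R) (x : state N M -> I -> nat)
    (f : I -> R -> R) (l : state N M -> I -> R) :
    (forall q k, l q k = if (x q k)%:R < qmax then eta%:R * a k else 0) ->
    \mean_q (\sum_k l q k * scaled eta (f k) (l q k)) =
    eta%:R * (\sum_k a k * f k (a k) -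
      \sum_k f k (a k) * (a k * \mean_q (qmax <= (x q k)%:R)%R%:R)).
  move=> lE; transitivity (\mean_q \sum_k
      eta%:R * (a k * f k (a k)) * (1 - (qmax <= (x q k)%:R)%R%:R)).
    apply: eq_bigr => q _; congr (_ * _); apply: eq_bigr => k _; rewrite lE.
    case: ltP => _; last by rewrite mul0r subrr mulr0.
    by rewrite /scaled [eta%:R * a k]mulrC mulfK ?gt_eqF//= subr0; ring.
  rewrite mean_lin -sumrB mulr_sumr; apply: eq_bigr => k _.
  by rewrite mean_sub mean1; ring.
rewrite mean_sub (revenueE M lams (@qc N M) F)//.
rewrite (revenueE N mus (@qs N M) G)// /fluid_profit; ring.
Qed.

(* Each full-buffer probability is controlled by their weighted sum, and no
   queue exceeds [K]. *)
Lemma profit_loss_le :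
  (`| profit_loss F G sc ss eta (fluid_profit F G lams mus) lam mu P | <=
   (eta%:R * ((\sum_j `|F j (lams j)| + \sum_i `|G i (mus i)|) *
      (Lambda / (2 * qmax))) + (\sum_j sc j + \sum_i ss i) * K%:R)%:E)%E.
Proof.
rewrite profit_lossE /= lee_fin.
pose full := \sum_j lams j * fullc j + \sum_i mus i * fulls i.
have fullc0 j : 0 <= lams j * fullc j.
  by rewrite mulr_ge0 ?(ltW (lams_gt0 j))// sumr_ge0// => q _; rewrite mulr_ge0.
have fulls0 i : 0 <= mus i * fulls i.
  by rewrite mulr_ge0 ?(ltW (mus_gt0 i))// sumr_ge0// => q _; rewrite mulr_ge0.
have fullc_le j : lams j * fullc j <= full.
  by rewrite /full (bigD1 j)//= -addrA lerDl addr_ge0// sumr_ge0.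
have fulls_le i : mus i * fulls i <= full.
  by rewrite /full [X in _ + X](bigD1 i)//= addrCA lerDl addr_ge0// sumr_ge0.
have full_le : full <= Lambda / (2 * qmax).
  rewrite ler_pdivlMr ?mulr_gt0// mulrC; exact: full_probability_le.
have price_le (I : finType) (a b : I -> R) (B : R) :
    (forall k, 0 <= b k <= B) -> `|\sum_k a k * b k| <= (\sum_k `|a k|) * B.
  move=> bB; apply: le_trans (ler_norm_sum _ _ _) _; rewrite mulr_suml.
  apply: ler_sum => k _; have /andP[b0 bk] := bB k.
  by rewrite normrM (ger0_norm b0) ler_wpM2l.
have queue_le (x : state N M -> nat) :
    (forall q, q \in box N M K -> (x q <= K)%N) -> 0 <= \mean_q (x q)%:R <= K%:R.
  move=> xK; apply/andP; split; first by rewrite sumr_ge0// => q _; rewrite mulr_ge0.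
  apply: (@le_trans _ _ (\mean_q K%:R)).
    by apply: mean_le => q qK _; rewrite ler_nat xK.
  by rewrite -mulr_suml -[X in _ <= X]mul1r -mean1 -!mulr_suml mulr1.
have qc_le j : 0 <= \mean_q (qc q j)%:R <= K%:R.
  by apply: queue_le => q; rewrite mem_box => /andP[/forallP].
have qs_le i : 0 <= \mean_q (qs q i)%:R <= K%:R.
  by apply: queue_le => q; rewrite mem_box => /andP[_ /forallP].
have pos (I : finType) (s : I -> R) : (forall k, 0 < s k) ->
    \sum_k `|s k| = \sum_k s k.
  by move=> s0; apply: eq_bigr => k _; rewrite gtr0_norm.
have hc : `|\sum_j F j (lams j) * (lams j * fullc j)| <= (\sum_j `|F j (lams j)|) * full.
  by apply: price_le => j; rewrite fullc0 fullc_le.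
have hs : `|\sum_i G i (mus i) * (mus i * fulls i)| <= (\sum_i `|G i (mus i)|) * full.
  by apply: price_le => i; rewrite fulls0 fulls_le.
have hqc := price_le M sc _ _ qc_le; have hqs := price_le N ss _ _ qs_le.
rewrite !pos// in hqc hqs.
apply: le_trans (ler_normD _ _) _; rewrite (mulrDl (\sum_j sc j)) addrA.
apply: lerD hqs; apply: le_trans (ler_normD _ _) _; apply: lerD hqc.
rewrite normrM gtr0_norm// ler_wpM2l ?(ltW etaR_gt0)//.
apply: le_trans (ler_normB _ _) _.
apply: (@le_trans _ _ ((\sum_j `|F j (lams j)| + \sum_i `|G i (mus i)|) * full)).
  by rewrite mulrDl lerD.
by rewrite ler_wpM2l// addr_ge0// sumr_ge0.
Qed.

End ProfitLoss.

End Stationary.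

(** * Existence of a stationary law *)

(** The states of [box N M K] without a waiting pair form a finite set closed under jumps. An
    invariant law of the chain restricted to it is then spread over all states as a finite
    mixture. *)
Lemma stationary_exists :
  exists P : probability (state N M) R, stationary E lam mu w P.
Proof.
pose s := [seq q <- box N M K | `[< no_waiting_pair E q >]].
have sP q : (q \in s) = `[< no_waiting_pair E q >] && (q \in box N M K).
  by rewrite mem_filter.
have s_jump q r : q \in s -> jump q r -> r \in s.
  rewrite !sP => /andP[/asboolP nwp qK] qr; apply/andP; split.
    by apply/asboolP; exact: no_waiting_pair_jump nwp qr.
  by rewrite -excess0 -leqn0 (leq_trans (excess_jump qr))// leqn0 excess0.
have s0 : (point : state N M) \in s.
  rewrite sP mem_box; apply/and3P; split.
  - by apply/asboolP => i j _; left; rewrite /qc ffunE.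
  - by apply/forallP => j; rewrite /qc ffunE.
  - by apply/forallP => i; rewrite /qs ffunE.
pose T : finType := seq_sub s.
pose Q (q r : T) := gen \1_[set val r] (val q).
have indicv (q r : T) : \1_[set val r] (val q) = (q == r)%:R :> R.
  have [->|qr] := eqVneq q r; rewrite indicE; first by rewrite mem_set.
  by rewrite memNset//= => /val_inj/eqP; rewrite (negPf qr).
have Qge0 q r : q != r -> 0 <= Q q r.
  move=> qr; apply: (generator_ge0 lam_ge0 mu_ge0 hw) => x _.
  by rewrite indicv (negPf qr) indicE ler0n.
(* The point indicators of [s] add up to 1 on [s], and no jump leaves [s], so their sum acts as a
   constant there. *)
have Qrow q : \sum_r Q q r = 0.
  under eq_bigr do rewrite -[Q _ _]mul1r.
  rewrite -generator_sum -[RHS](generator_cst E lam mu w 1 (val q)).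
  have one (x : T) : \sum_(r : T) 1 * \1_[set val r] (val x) = 1 :> R.
    rewrite (bigD1 x)//= indicv eqxx mulr1 big1 ?addr0// => r rx.
    by rewrite indicv eq_sym (negPf rx) mulr0.
  apply: (generator_eq lam_ge0 mu_ge0 hw) => r /(s_jump _ _ (valP q)) rs.
  by rewrite one (one (SeqSub rs)).
have [p [p0 p1 pQ]] := finite_invariant_distribution (SeqSub s0) Qge0 Qrow.
have [P [PE EP]] := finite_mixture (SeqSub s0) val p0 p1.
exists P; split.
  rewrite PE -p1; congr EFin; apply: eq_bigr => t _.
  rewrite indicE mem_set ?mulr1//; have := valP t; rewrite sP => /andP[/asboolP].
  by [].
move=> r; rewrite EP; congr EFin.
have [rs|rs] := boolP (r \in s); first exact: (pQ (SeqSub rs)).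
(* The indicator of a state outside [s] is zero on [s] and at every state reached from [s], so its
   balance equation is trivial. *)
rewrite big1// => t _; apply/eqP; rewrite mulf_eq0; apply/orP; right; apply/eqP.
rewrite -(generator_cst E lam mu w 0 (val t)).
have r0 q : q \in s -> \1_[set r] q = 0 :> R.
  by move=> qs; rewrite indicE memNset//= => qr; rewrite -qr qs in rs.
apply: (generator_eq lam_ge0 mu_ge0 hw) => q /(s_jump _ _ (valP t)) qs.
by rewrite !r0//; exact: valP.
Qed.

End FluidPolicy.

(** * Square-root growth of the loss *)

Theorem theorem1 (R : realType) (N M : finType) (E : {set N * M})
    (IF : M -> interval R) (IG : N -> interval R)
    (F : M -> R -> R) (G : N -> R -> R) (sc : M -> R) (ss : N -> R)
    (lams : M -> R) (mus : N -> R) (chis : N -> M -> R)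
    (hF : forall j, inverse_demand (IF j) (F j))
    (hG : forall i, inverse_supply (IG i) (G i))
    (hsc : forall j, 0 < sc j) (hss : forall i, 0 < ss i)
    (hopt : fluid_optimal E IF IG F G lams mus chis)
    (hlams : forall j, 0 < lams j) (hmus : forall i, 0 < mus i)
    (gamma : R) (hgamma : 0 < gamma)
    (w : nat -> matching R N M) (hw : forall eta, max_weight E (w eta)) :
  let gammastar := fluid_profit F G lams mus in
  let qmax eta := gamma * Num.sqrt eta%:R in
  let lam eta := fluid_price_customer (N := N) eta lams (qmax eta) in
  let mu eta := fluid_price_server (M := M) eta mus (qmax eta) in
  (forall eta, (0 < eta)%N ->
     exists P : probability (state N M) R,
       stationary E (lam eta) (mu eta) (w eta) P) /\
  (forall P : nat -> probability (state N M) R,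
     (forall eta, (0 < eta)%N ->
        stationary E (lam eta) (mu eta) (w eta) (P eta)) ->
     exists C : R, \forall eta \near \oo,
       (`| profit_loss F G sc ss eta gammastar (lam eta) (mu eta) (P eta) |
          <= (C * Num.sqrt eta%:R)%:E)%E).
Proof.
case: hopt => -[[lamsE musE] chis_ge0 chis_eq0 _] _ gammastar qmax lam mu.
have qmax_gt0 eta : (0 < eta)%N -> 0 < qmax eta.
  by move=> eta0; rewrite mulr_gt0// sqrtr_gt0 ltr0n.
(* A length below [qmax eta] is at most its integer part, and one arrival may still be added to
   it. *)
pose K eta := (Num.truncn (qmax eta)).+1.
have qmaxK eta n : (0 < eta)%N -> n%:R < qmax eta -> (n < K eta)%N.
  by move=> /qmax_gt0/ltW q0 /ltW; rewrite ltnS truncn_ge_nat.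
split=> [eta eta0|P statP].
  exact: (stationary_exists hlams hmus eta0
    (fun n => qmaxK eta n eta0) (hw eta)).
pose B := \sum_j `|F j (lams j)| + \sum_i `|G i (mus i)|.
pose S := \sum_j sc j + \sum_i ss i.
pose Lambda := \sum_j lams j + \sum_i mus i.
(* The first term is the lost revenue [eta * B * Lambda / (2 * qmax eta)] divided by the square root
   of [eta]. The second bounds the waiting cost [S * K eta], since [K eta] is at most [qmax eta + 1]
   and the square root of [eta] is at least 1. *)
exists (B * (Lambda / (2 * gamma)) + S * (gamma + 1)).
near=> eta.
have eta0 : (0 < eta)%N by near: eta; exact: nbhs_infty_gt.
apply: le_trans (profit_loss_le hlams hmus lamsE musE chis_ge0 chis_eq0 eta0
  (qmax_gt0 _ eta0) (fun n => qmaxK eta n eta0) (hw eta) (statP _ eta0)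
  F G hsc hss) _.
rewrite lee_fin -/S -/Lambda [leRHS]mulrDl -[X in X * (_ / (2 * qmax eta))]/B; set r := Num.sqrt eta%:R.
have r1 : 1 <= r by rewrite -sqrtr1 ler_sqrt// ler1n.
have rr : eta%:R = r * r :> R by rewrite -expr2 sqr_sqrtr.
apply: lerD.
  rewrite rr /qmax -/r le_eqVlt; apply/orP; left; apply/eqP; field.
  by rewrite !gt_eqF// (lt_le_trans ltr01).
rewrite -mulrA ler_wpM2l//.
  by rewrite addr_ge0// sumr_ge0// => k _; apply/ltW.
have : (Num.truncn (qmax eta))%:R <= qmax eta.
  by rewrite truncn_le ltW// qmax_gt0.
rewrite /K -natr1 /qmax -/r; nra.
Unshelve. all: by end_near.
Qed.
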